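(* Let $G\le\mathrm{Homeo}(X_Q\times\Sigma^{\mathbb Z^d})$ be the group generated by $\mathrm{GL}(d,\mathbb Z)$ and $\mathrm{Aut}(X_Q\times\Sigma^{\mathbb Z^d})$. Let $M=(Q,\Sigma,N,\delta)$ be a $d$-dimensional Turing machine, considered in the moving head model, let $a\in\Sigma$ and $g\in G$, and let $b\in\Sigma$ be the symbol with $g(a^{\mathbb Z^d})=b^{\mathbb Z^d}$. If $M$ is physically universal on $a$-finite configurations, then $g\circ M\circ g^{-1}$ is physically universal on $b$-finite configurations.
   Context: Fix a dimension $d\ge 1$, a finite nonempty state set $Q$ and a finite alphabet $\Sigma$. Intervals $[a,b]$ are integer intervals. **Configurations and patterns.** For a symbol $\#\notin Q$, $X_Q\subset (Q\cup\{\#\})^{\mathbb Z^d}$ is the set of configurations in which at most one coordinate carries an element of $Q$. For $q\in Q$, $\vec v\in\mathbb Z^d$, $q[\vec v]\in X_Q$ is the unique configuration with value $q$ at $\vec v$. For $D\subset\mathbb Z^d$, $\mathcal P_{Q,\Sigma}(D)$ is the set of restrictions to $D$ of elements of $X_Q\times\Sigma^{\mathbb Z^d}$, and $\mathcal P^*_{Q,\Sigma}(D)$ the subset of those in which an element of $Q$ (the head) occurs; write $\mathcal P_{Q,\Sigma}(m)$, $\mathcal P^*_{Q,\Sigma}(m)$ when $D=[0,m-1]^d$. $\sqcup$ denotes union of partial configurations with disjoint domains; an element of $\Sigma^E$ is regarded as having $\#$ at each coordinate of $E$. $\Sigma^{\mathbb Z^d}$ is regarded as a subset of $X_Q\times\Sigma^{\mathbb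 Z^d}$ via $x\mapsto(\#^{\mathbb Z^d},x)$; in particular $a^{\mathbb Z^d}$ means $(\#^{\mathbb Z^d},a^{\mathbb Z^d})$. Translation: $\tau_{\vec v}(x)_{\vec w}=x_{\vec w+\vec v}$. **Groups.** $\mathrm{GL}(d,\mathbb Z)$ acts on $X_Q\times\Sigma^{\mathbb Z^d}$ by $(Ax)_{\vec v}=x_{A^{-1}\vec v}$. $\mathrm{Aut}(X_Q\times\Sigma^{\mathbb Z^d})$ is the group of self-homeomorphisms commuting with all translations. **Turing machines (moving head model).** $M=(Q,\Sigma,N,\delta)$ with $N\subset\mathbb Z^d$ finite and $\delta:Q\times\Sigma^N\to Q\times\Sigma^N\times N$ acts on $X_Q\times\Sigma^{\mathbb Z^d}$ by $M(\#^{\mathbb Z^d},x)=(\#^{\mathbb Z^d},x)$ and $M(q[\vec v],x)=(p[\vec v+\vec w],y)$, where $\delta(q,\tau_{\vec v}(x)|_N)=(p,P,\vec w)$ and $y$ is obtained from $x$ by replacing the contents of $N+\vec v$ with $P$. **Physical universality on $a$-finite configurations.** A self-map $F$ of $X_Q\times\Sigma^{\mathbb Z^d}$ (such as $M$ or $g\circ M\circ g^{-1}$) is physically universal on $a$-finite configurations if for all $k,m\in\mathbb N$ and all $(P_0,\dots,P_{k-1}),(R_0,\dots,R_{k-1})\in\mathcal P^*_{Q,\Sigma}(m)^k$ such that the $F$-orbits of $P_j\sqcup a^{\mathbb Z^d\setminus[0,m-1]^d}$ are pairwise disjoint for distinct $j$, there exist a partial configuration $x\in\mathcal P_{Q,\Sigma}(\mathbb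 Z^d\setminus[0,m-1]^d)$ (necessarily headless if $k\geq1$) and $t\in\mathbb N$ with $F^t(P_j\sqcup x)|_{[0,m-1]^d}=R_j$ for all $j$. *)

(* Defs.v *)
From HB Require Import structures.
From mathcomp Require Import all_boot all_order all_algebra finmap.
From mathcomp Require Import all_classical.
From mathcomp Require Import topology.

Set Implicit Arguments.
Unset Strict Implicit.
Unset Printing Implicit Defensive.

Import GRing.Theory.
Local Open Scope classical_set_scope.
Local Open Scope ring_scope.

Section Homeo.
Variable T : topologicalType.

Record homeo := Homeo {
  homeo_fun :> T -> T;
  homeo_inv : T -> T;
  homeo_funK : cancel homeo_fun homeo_inv;
  homeo_invK : cancel homeo_inv homeo_fun;
  homeo_cts : continuous homeo_fun;
  homeo_inv_cts : continuous homeo_inv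
}.

Lemma homeoP (f g : homeo) : f =1 g -> f = g.
Proof.
case: f g => [f f' fK f'K cf cf'] [g g' gK g'K cg cg'] /= fg.
have {}fg : f = g by exact: funext.
subst g; have f'g' : f' = g' by apply: funext => x; rewrite -{1}(g'K x) fK.
by subst g'; congr Homeo; exact: Prop_irrelevance.
Qed.

HB.instance Definition _ := gen_eqMixin homeo.
HB.instance Definition _ := gen_choiceMixin homeo.

Lemma homeo1_cts : continuous (id : T -> T). Proof. by move=> x. Qed.

Definition homeo1 : homeo :=
  @Homeo id id (fun=> erefl) (fun=> erefl) homeo1_cts homeo1_cts.

Definition homeoV (f : homeo) : homeo :=
  Homeo (homeo_invK f) (homeo_funK f) (@homeo_inv_cts f) (@homeo_cts f).

Lemma homeoM_cts (f g : T -> T) :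
  continuous f -> continuous g -> continuous (f \o g).
Proof. by move=> cf cg x; apply: continuous_comp; [exact: cg|exact: cf]. Qed.

Definition homeoM (f g : homeo) : homeo :=
  @Homeo (f \o g) (homeo_inv g \o homeo_inv f)
    (can_comp (homeo_funK f) (homeo_funK g))
    (can_comp (homeo_invK g) (homeo_invK f))
    (homeoM_cts (@homeo_cts f) (@homeo_cts g))
    (homeoM_cts (@homeo_inv_cts g) (@homeo_inv_cts f)).

Lemma homeoMA : associative homeoM. Proof. by move=> f g h; exact: homeoP. Qed.
Lemma homeo1M : left_id homeo1 homeoM. Proof. by move=> f; exact: homeoP. Qed.
Lemma homeoM1 : right_id homeo1 homeoM. Proof. by move=> f; exact: homeoP. Qed.
Lemma homeoVM : left_inverse homeo1 homeoV homeoM.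
Proof. by move=> f; apply: homeoP => x; exact: homeo_funK. Qed.
Lemma homeoMV : right_inverse homeo1 homeoV homeoM.
Proof. by move=> f; apply: homeoP => x; exact: homeo_invK. Qed.

HB.instance Definition _ :=
  isGroup.Build homeo homeoMA homeo1M homeoM1 homeoVM homeoMV.

End Homeo.

Definition is_subgroup (gT : groupType) (H : set gT) : Prop :=
  [/\ H 1%g, (forall x y, H x -> H y -> H (x * y)%g)
    & (forall x, H x -> H (x^-1)%g)].

Definition generated (gT : groupType) (A : set gT) : set gT :=
  smallest (@is_subgroup gT) A.

Section Configurations.
Variables (d : nat) (Q Sigma : finType).

Local Notation Zd := 'cV[int]_d.

(* [None] is the symbol #. *)
Definition at_most_one_head :
    set {ptws Zd -> discrete_topology (option Q)} :=
  [set h | forall u v, h u != None -> h v != None -> u = v].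

Definition XQ : Type := at_most_one_head.
HB.instance Definition _ := Topological.on XQ.

Definition conf : Type := (XQ * {ptws Zd -> discrete_topology Sigma})%type.
HB.instance Definition _ := Topological.on conf.

Definition cells (c : conf) (v : Zd) : option Q * Sigma :=
  (set_val c.1 v, c.2 v).

Definition noheadf : Zd -> option Q := fun=> None.
Definition singlef (q : Q) (v : Zd) : Zd -> option Q :=
  fun u => if u == v then Some q else None.

Lemma nohead_subproof : at_most_one_head noheadf. Proof. by []. Qed.

Lemma single_subproof q v : at_most_one_head (singlef q v).
Proof.
move=> u w; rewrite /singlef.
by case: (u =P v) => [->|//] _; case: (w =P v) => [->|//].
Qed.

Definition nohead : XQ := SigSub (mem_set nohead_subproof).

Definition single (q : Q) (v : Zd) : XQ := SigSub (mem_set (@single_subproof q v)).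

Definition const_conf (a : Sigma) : conf := (nohead, fun=> a).

Section Reindex.
Variables (f : Zd -> Zd) (f_inj : injective f).

Lemma reindex_subproof (h : XQ) : at_most_one_head (set_val h \o f).
Proof.
move=> u v hu hv; apply: f_inj.
exact: (set_mem (valP h) (f u) (f v)).
Qed.

Definition reindex (c : conf) : conf :=
  (SigSub (mem_set (@reindex_subproof c.1)), c.2 \o f).

Lemma cells_reindex c v : cells (reindex c) v = cells c (f v).
Proof. by []. Qed.
End Reindex.

Definition translate (v : Zd) : conf -> conf :=
  reindex (@addIr Zd v).

Lemma invmx_mul_inj (A : 'M[int]_d) :
  A \in unitmx -> injective (fun v : Zd => invmx A *m v).
Proof. by move=> uA; apply: can_inj (mulKVmx uA). Qed.

Definition gl_act (A : 'M[int]_d) (uA : A \in unitmx) : conf -> conf :=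
  reindex (invmx_mul_inj uA).

Definition GLZ : set (homeo conf) :=
  [set h | exists A (uA : A \in unitmx), (h : conf -> conf) = @gl_act A uA].

Definition AutX : set (homeo conf) :=
  [set h | forall v c, h (translate v c) = translate v (h c)].

Definition groupG : set (homeo conf) := generated (GLZ `|` AutX).

Record turing_machine := TuringMachine {
  tm_nbhd : {fset Zd};
  tm_delta : Q * {ffun tm_nbhd -> Sigma} -> Q * {ffun tm_nbhd -> Sigma} * tm_nbhd
}.

Definition head_pos (h : XQ) : option (Q * Zd) :=
  if pselect (exists qv : Q * Zd, h = single qv.1 qv.2) is left e
  then Some (projT1 (cid e)) else None.

Lemma head_nohead : head_pos nohead = None.
Proof.
rewrite /head_pos; case: pselect => // e; exfalso.
case: e => -[q v] /= /(congr1 (fun h : XQ => set_val h v)).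
by rewrite !set_valE /= /noheadf /singlef eqxx.
Qed.

Lemma head_single q v : head_pos (single q v) = Some (q, v).
Proof.
rewrite /head_pos; case: pselect => [e|]; last by case; exists (q, v).
case: cid => -[p w] /= /(congr1 (fun h : XQ => set_val h v)).
by rewrite !set_valE /= /singlef eqxx; case: eqP => // -> [->].
Qed.

Lemma XQ_cases (h : XQ) : h = nohead \/ exists q v, h = single q v.
Proof.
have [[v hv]|hN] := pselect (exists v, set_val h v != None).
  right; case E: (set_val h v) hv => [q|] // _.
  exists q, v; apply: val_inj; apply: funext => u /=; rewrite /singlef.
  have [->//|uv] := eqVneq u v.
  case F: (set_val h u) => [p|//]; move/eqP: uv; case.
  by apply: (set_mem (valP h)); rewrite -[val h]/(set_val h) ?E ?F.
left; apply: val_inj; apply: funext => u /=.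
case E: (set_val h u) => [q|//]; case: hN; exists u.
by rewrite E.
Qed.

Definition tm_step (M : turing_machine) (c : conf) : conf :=
  if head_pos c.1 is Some (q, v) then
    let: (p, P, w) := tm_delta (q, [ffun n : tm_nbhd M => c.2 (val n + v)]) in
    (single p (v + val w),
     fun u => if insub (u - v) is Some n then P n else c.2 u)
  else c.

Lemma tm_step_nohead M (x : Zd -> Sigma) : tm_step M (nohead, x) = (nohead, x).
Proof. by rewrite /tm_step /= head_nohead. Qed.

Lemma tm_step_single M q v (x : Zd -> Sigma) p P w :
  tm_delta (q, [ffun n : tm_nbhd M => x (val n + v)]) = (p, P, w) ->
  tm_step M (single q v, x) =
  (single p (v + val w),
   fun u => if insub (u - v) is Some n then P n else x u).
Proof. by rewrite /tm_step /= head_single => ->. Qed.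

Definition pattern (D : set Zd) : Type := D -> option Q * Sigma.

Definition restr (D : set Zd) (c : conf) : pattern D := sigL D (cells c).
Arguments restr D c : clear implicits.

Definition patterns (D : set Zd) : set (pattern D) := range (restr D).
Arguments patterns D : clear implicits.

Definition headed_patterns (D : set Zd) : set (pattern D) :=
  patterns D `&` [set p | exists v, (p v).1 != None].
Arguments headed_patterns D : clear implicits.

Definition const_pattern (D : set Zd) (a : Sigma) : pattern D :=
  fun=> (None, a).
Arguments const_pattern D a : clear implicits.

(* c is the union of p and x. At most one c qualifies; when p and x are in
   [patterns], one exists unless both contain a head. *)
Definition is_union (D : set Zd) (p : pattern D) (x : pattern (~` D)) (c : conf) :=
  restr D c = p /\ restr (~` D) c = x.

Definition box (m : nat) : set Zd := [set v | forall i, 0 <= v i 0 < m%:Z].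

(* F need not be invertible; for bijective F, two-sided orbits are disjoint
   exactly when these forward orbits are. *)
Definition fwd_orbit (F : conf -> conf) (c : conf) : set conf :=
  range (fun n => iter n F c).

Definition physically_universal (F : conf -> conf) (a : Sigma) : Prop :=
  forall (k m : nat) (P R : 'I_k -> pattern (box m)) (C : 'I_k -> conf),
    (forall j, headed_patterns (box m) (P j)) ->
    (forall j, headed_patterns (box m) (R j)) ->
    (forall j, is_union (P j) (const_pattern (~` box m) a) (C j)) ->
    trivIset setT (fun j => fwd_orbit F (C j)) ->
    exists (x : pattern (~` box m)) (t : nat), patterns (~` box m) x /\
      forall j, exists2 c, is_union (P j) x c & restr (box m) (iter t F c) = R j.

End Configurations.

Arguments physically_universal {d Q Sigma}.
Arguments tm_step {d Q Sigma}.
Arguments groupG {d Q Sigma}.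

(* Main.v *)
(** Every g in G, as well as its inverse, is local: the cell of g c at w only
    depends on the cells of c in a finite window D w, and each cell lies in
    finitely many windows (for automorphisms, by compactness).  Moreover g
    preserves headless configurations: those periodic in one direction are
    headless and dense among the headless ones, and an automorphism preserves
    periodicity.

    Given patterns on a box B, pull the problem back through g^-1: outside the
    finite set U of cells whose g^-1-window meets B, the configurations
    g^-1 (P_j + b^...) all agree with a^Z^d.  Take a solution y_j for M on a box
    B' (placed anywhere, as M commutes with translations) containing U, the
    g-windows of B, and all the g-windows meeting U.  Then the g (y_j) solve the
    problem on B: at a cell outside B, either its window lies in B' and g (y_j)
    carries b there, or its window avoids U and the y_j coincide on it. *)

Require Import Defs.
From mathcomp Require Import all_boot all_order all_algebra finmap.
From mathcomp Require Import all_classical topology.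
From mathcomp Require Import zify.

Set Implicit Arguments.
Unset Strict Implicit.
Unset Printing Implicit Defensive.

Import GRing.Theory.
Local Open Scope classical_set_scope.
Local Open Scope ring_scope.

(** * The product topology on configurations, cell by cell *)

Lemma cvg_ptws_discrete (I : eqType) (T : choiceType)
    (F : set_system {ptws I -> discrete_topology T})
    (f : {ptws I -> discrete_topology T}) :
  Filter F -> (forall i, F [set g | g i = f i]) -> F --> f.
Proof.
move=> FF Ff; apply/cvg_sup => i; apply/cvg_image.
  by rewrite eqEsubset; split=> // t _; exists (fun=> t).
move=> A /nbhs_singleton Afi.
exists [set g | A (g i)].
  by apply: filterS (Ff i) => g /= ->.
rewrite eqEsubset; split=> [t [g Ag <-] //|t At].
by exists (fun=> t).
Qed.

Lemma ptws_discrete_nbhs (I : eqType) (T : choiceType)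
    (f : {ptws I -> discrete_topology T}) i :
  nbhs f [set g | g i = f i].
Proof.
exact: (@proj_continuous I (fun=> discrete_topology T) i f _
  (@discrete_set1 (discrete_topology T) (f i))).
Qed.

Section Space.
Variables (d : nat) (Q Sigma : finType).
Local Notation Zd := 'cV[int]_d.
Local Notation conf := (conf d Q Sigma).
Implicit Types (c : conf) (h : conf -> conf) (v w : Zd) (B : set Zd).

Lemma conf_ext c c' : cells c =1 cells c' -> c = c'.
Proof.
case: c c' => [x y] [x' y'] e; congr pair.
  by apply: val_inj; apply: funext => v; case: (e v).
by apply: funext => v; case: (e v).
Qed.

Lemma nbhs_cell c v : nbhs c [set c' | cells c' v = cells c v].
Proof.
exists ([set x | set_val x v = set_val c.1 v], [set y | y v = c.2 v]) => /=.
  split; last exact: ptws_discrete_nbhs.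
  exact: (@initial_continuous _ _ (set_val : XQ d Q -> _) c.1 _
    (ptws_discrete_nbhs (set_val c.1) v)).
by move=> [x y] /= [ex ey]; congr pair.
Qed.

Lemma cvg_conf (F : set_system conf) c : Filter F ->
  (forall v, F [set c' | cells c' v = cells c v]) -> F --> c.
Proof.
move=> FF Fc.
suff : (fst @ F --> c.1) /\ (snd @ F --> c.2).
  case=> F1 F2 A [[A1 A2] /= [/F1 nA1 /F2 nA2] sA].
  have FA : F (fst @^-1` A1 `&` snd @^-1` A2) by exact: filterI.
  rewrite nbhs_filterE; apply: (@filterS _ F _ _ _ _ FA).
  by move=> [x y] [/= ? ?]; exact: sA.
split.
  move=> A [_ [[B oB <-] Bc sBA]].
  apply: (@filterS _ F _ ((set_val \o fst) @^-1` B)).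
    by move=> c' /= Bc'; exact: sBA.
  have : (set_val \o fst) @ F --> (set_val c.1 : {ptws _ -> _}).
    apply: cvg_ptws_discrete => v.
    by apply: (@filterS _ F _ _ _ _ (Fc v)) => c' e; exact: (congr1 fst e).
  by apply; exact: open_nbhs_nbhs.
apply: cvg_ptws_discrete => v.
by apply: (@filterS _ F _ _ _ _ (Fc v)) => c' e; exact: (congr1 snd e).
Qed.

(** A cell takes finitely many values, so an ultrafilter selects one value in each; two selected
    heads would already coexist in a single configuration. *)
Lemma compact_conf : compact [set: conf].
Proof.
rewrite compact_ultra => F FU _.
have val v : exists p, F [set c | cells c v = p].
  apply: contrapT => /forallNP Np.
  have /filter_ex[c /= /(_ (cells c v))] :
      \forall c \near F, forall p, cells c v <> p.
    apply: filter_forall => p.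
    by have [/Np|] := in_ultra_setVsetC [set c | cells c v = p] FU.
  by [].
have {val}[p Fp] := choice val.
have PF : ProperFilter F by exact: ultra_proper.
have amo : at_most_one_head (fst \o p).
  move=> u v /= hu hv.
  have FI : F ([set c | cells c u = p u] `&` [set c | cells c v = p v]).
    exact: filterI.
  have [c [/= cu cv]] := filter_ex FI.
  by apply: (set_mem (valP c.1)); move: hu hv; rewrite -cu -cv.
exists (SigSub (mem_set amo), snd \o p); split=> //.
apply: cvg_conf => v; apply: (@filterS _ F _ _ _ _ (Fp v)) => c /= ->.
by rewrite /cells /= set_valE /=; case: (p v).
Qed.

(** * Continuous maps and finite windows *)

Definition agree B c c' := forall v, B v -> cells c v = cells c' v.

Definition depends h (D : Zd -> set Zd) :=
  forall c c' w, agree (D w) c c' -> cells (h c) w = cells (h c') w.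

Definition locally_finite (D : Zd -> set Zd) :=
  (forall w, finite_set (D w)) /\ (forall u, finite_set [set w | D w u]).

(** Continuity gives a finite window near each configuration; compactness turns these into one
    window valid everywhere. *)
Lemma continuous_window h w : continuous h ->
  exists2 B, finite_set B &
    forall c c', agree B c c' -> cells (h c) w = cells (h c') w.
Proof.
move=> hcts.
pose cyl c (X : {fset Zd}) := [set c' | agree [set` X] c c'].
have cyl_nbhs c X : nbhs c (cyl c X).
  have := @filter_bigI _ _ X (fun v => [set c' | cells c' v = cells c v]) _
    (nbhs_filter c) (fun v _ => nbhs_cell c v).
  by apply: filterS => c' cc' v /cc'.
have cyl_filter c : Filter (filter_from setT (cyl c)).
  apply: filter_from_filter; first by exists fset0.
  move=> X Y _ _; exists (X `|` Y)%fset => // c' cc'.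
  by split=> v /= vX; apply: cc'; rewrite /= in_fsetU vX ?orbT.
have cyl_cvg c : filter_from setT (cyl c) --> c.
  apply: cvg_conf => v; exists [fset v]%fset => // c' cc'.
  by apply/esym/cc'; rewrite /= inE.
(* Along [G], eventually means for all sufficiently large finite sets of cells. *)
pose G := filter_from setT (fun X : {fset Zd} => [set Y | (X `<=` Y)%fset]).
have FG : Filter G.
  apply: filter_from_filter; first by exists fset0.
  move=> X Y _ _; exists (X `|` Y)%fset => // Z /=.
  by rewrite fsubUset => /andP[].
have PG : ProperFilter G.
  by split=> // -[X _ /(_ X (fsubset_refl X))].
have := (compact_near_coveringP _).1 compact_conf _ G
  (fun X c => forall c', agree [set` X] c c' -> cells (h c) w = cells (h c') w)
  FG.
case/(_ _)/filter_ex => [c _|X XP].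
  have /cyl_cvg[X _ Xh] : nbhs c [set c' | cells (h c') w = cells (h c) w].
    exact: (hcts c _ (nbhs_cell (h c) w)).
  exists (cyl c X, [set Y | (X `<=` Y)%fset]); first by split=> //=; exists X.
  move=> [c1 Y] [/= cc1 /fsubsetP XY] c2 c12; rewrite (Xh c1) //.
  apply/esym/Xh => v Xv; rewrite (cc1 v) //; apply: c12.
  exact: XY.
by exists [set` X]; [by apply/finite_fsetP; exists X|move=> c; exact: XP].
Qed.

(** * Headless configurations and locality of the group elements *)

Definition headless c := c.1 = nohead d Q.

Lemma headlessP c : headless c <-> forall v, (cells c v).1 = None.
Proof.
split=> [e v|cN]; first by rewrite /cells e.
by apply: val_inj; apply: funext => v; exact: (cN v).
Qed.

Lemma not_headless c : ~ headless c -> exists v, (cells c v).1 != None.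
Proof.
apply: contra_notP => /forallNP cN; apply/headlessP => v.
by apply/eqP/negPn/negP; exact: cN.
Qed.

Definition local_headless_preserving h :=
  (exists2 D, depends h D & locally_finite D) /\
  (forall c, headless c -> headless (h c)).

Lemma local_headless_preserving_comp h1 h2 :
  local_headless_preserving h1 -> local_headless_preserving h2 ->
  local_headless_preserving (h1 \o h2).
Proof.
move=> [[D1 dep1 [fin1 fin1']] hl1] [[D2 dep2 [fin2 fin2']] hl2].
split; last by move=> c /hl2/hl1.
exists (fun w => \bigcup_(u in D1 w) D2 u).
  move=> c c' w cc'; apply: dep1 => u D1u; apply: dep2 => v D2v.
  by apply: cc'; exists u.
split=> [w|v]; first exact: bigcup_finite.
apply: (@sub_finite_set _ _
  (\bigcup_(u in [set u | D2 u v]) [set w | D1 w u])).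
  by move=> w [u D1u D2v]; exists u.
by apply: bigcup_finite => // u _; exact: fin1'.
Qed.

Lemma local_headless_preserving_reindex h (f f' : Zd -> Zd) :
  cancel f f' -> (forall c w, cells (h c) w = cells c (f w)) ->
  local_headless_preserving h.
Proof.
move=> fK hE; split; last first.
  by move=> c /headlessP cN; apply/headlessP => v; rewrite hE.
exists (fun w => [set f w]).
  by move=> c c' w cc'; rewrite !hE; exact: cc'.
split=> [w|u]; first exact: finite_set1.
by apply: (@sub_finite_set _ _ [set f' u]) => [w /= ->|] //; rewrite fK.
Qed.

(** Centred at the origin, unlike [box], so that every finite set of cells fits into some cube. *)
Definition cube (K : nat) : set Zd :=
  [set v | forall i, (absz (v i ord0) < K)%N].

Lemma finite_sub_cube B : finite_set B -> exists K, B `<=` cube K.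
Proof.
move=> /finite_fsetP[X ->].
exists (\sum_(v <- X) \sum_i absz (v i ord0)).+1 => v vX i.
by rewrite ltnS (big_rem v) //= (bigD1 i) //= -addnA leq_addr.
Qed.

(* A headless configuration whose image has a head at w would agree on the
   window of w with a headless configuration invariant under a translation by
   e <> 0, whose image would have heads at both w and w + e. *)
Lemma AutX_local (g : homeo conf) : (0 < d)%N -> AutX g ->
  local_headless_preserving g.
Proof.
move=> d_gt0 gA.
have [B finB winB] := @continuous_window g 0 (@homeo_cts _ g).
pose D (w : Zd) := [set u + w | u in B].
have depD : depends g D.
  move=> c c' w cc'.
  have shift (x : conf) : cells (g x) w = cells (g (translate w x)) 0.
    by rewrite gA cells_reindex add0r.
  rewrite !shift; apply: winB => u Bu.
  by rewrite !cells_reindex; apply: cc'; exists u.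
split.
  exists D => //; split=> [w|u]; first exact: finite_image.
  apply: (@sub_finite_set _ _ [set u - v | v in B]); last exact: finite_image.
  by move=> w [v Bv <-]; exists v => //; rewrite addrC addKr.
move=> c cN; apply/headlessP => w; apply: contrapT => /eqP hw.
have [K DK] : exists K, D w `<=` cube K by apply/finite_sub_cube/finite_image.
pose i0 := Ordinal d_gt0.
(* The map [r] reduces coordinate [i0] modulo [N] into the interval from -(K+1) to K, hence fixes
   [cube K]. The successors keep [N] nonzero when [K] is 0. *)
pose N : int := (K.+1 + K.+1)%:Z.
pose e : Zd := \col_i (if i == i0 then N else 0).
pose r (u : Zd) : Zd :=
  \col_i (if i == i0 then ((u i ord0 + K.+1%:Z) %% N)%Z - K.+1%:Z
          else u i ord0).
pose c' : conf := (nohead d Q, c.2 \o r).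
have c'e : translate e c' = c'.
  apply: conf_ext => u; rewrite cells_reindex /cells /=; congr (_, c.2 _).
  apply/colP => i; rewrite !mxE; case: eqP => // _.
    by rewrite [u i ord0 + N + _]addrAC modzDr.
  by rewrite addr0.
have cc' : agree (D w) c c'.
  move=> u /DK uK; rewrite /cells /= cN; congr (_, c.2 _).
  apply/colP => i; rewrite !mxE; case: eqP => // ->.
  have uK0 := uK i0; rewrite modz_small; first by rewrite addrK.
  by rewrite /N; lia.
have hw' : (cells (g c') w).1 != None by rewrite -(depD _ _ _ cc').
have hwe : (cells (g c') (w + e)).1 != None.
  by rewrite -(cells_reindex (@addIr _ e)) -/(translate e _) -gA c'e.
have we : w = w + e by exact: (set_mem (valP (g c').1)) hw' hwe.
have : w i0 ord0 = w i0 ord0 + N :> int by rewrite {1}we !mxE eqxx.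
by rewrite /N; lia.
Qed.

Lemma GLZ_inv_cells (g : homeo conf) A (uA : A \in unitmx) :
  (g : conf -> conf) = @gl_act d Q Sigma A uA ->
  forall c w, cells (homeo_inv g c) w = cells c (A *m w).
Proof.
move=> gE c w; rewrite -[in RHS](homeo_invK g c) gE cells_reindex.
by rewrite mulKmx.
Qed.

(** Including the inverse in the property makes it define a subgroup, so only the generators need
    checking. *)
Lemma groupG_local (g : homeo conf) : (0 < d)%N -> groupG g ->
  local_headless_preserving g /\ local_headless_preserving (homeo_inv g).
Proof.
move=> d_gt0 gG.
apply: (gG [set g : homeo conf | local_headless_preserving g /\
  local_headless_preserving (homeo_inv g)]).
split.
  split=> /=.
  - have idl : local_headless_preserving id.
      by apply: (@local_headless_preserving_reindex _ id id).
    exact: (conj idl idl).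
  - move=> x y [x1 x2] [y1 y2].
    by split; apply: local_headless_preserving_comp.
  - by move=> x [].
move=> {gG}g [[A [uA gE]]|gA]; split.
- by apply: (@local_headless_preserving_reindex _ _ (mulmx A)
    (mulKVmx uA)) => c w; rewrite gE.
- exact: local_headless_preserving_reindex (mulKmx uA) (GLZ_inv_cells gE).
- exact: AutX_local.
- apply: (@AutX_local (homeoV g)) => // v c /=.
  by apply: (can_inj (homeo_funK g)); rewrite gA !homeo_invK.
Qed.

(** * Translation invariance of Turing machines *)

Lemma translate_single q u v x :
  translate v (single q u, x) = (single q (u - v), x \o (+%R^~ v)) :> conf.
Proof.
apply: conf_ext => w; rewrite cells_reindex /cells /= !set_valE /= /singlef.
by rewrite [w == _]eq_sym subr_eq [u == _]eq_sym.
Qed.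

Lemma tm_step_translate (M : turing_machine d Q Sigma) v c :
  tm_step M (translate v c) = translate v (tm_step M c).
Proof.
case: c => h x; have [->|[q [u ->]]] := XQ_cases h.
  have e : translate v (nohead d Q, x) = (nohead d Q, x \o (+%R^~ v)).
    exact: conf_ext.
  by rewrite tm_step_nohead e tm_step_nohead.
rewrite translate_single.
case E : (tm_delta (q, [ffun n : tm_nbhd M => x (val n + u)])) => [[p P] w].
rewrite (tm_step_single E) (@tm_step_single _ _ _ M q (u - v) _ p P w).
  rewrite translate_single addrAC; congr pair; apply: funext => y /=.
  by rewrite opprB addrCA addrC addrAC.
rewrite -E; congr (tm_delta (_, _)).
by apply/ffunP => n; rewrite !ffunE /= -addrA subrK.
Qed.

(** * Universality on arbitrary regions and its transport by conjugation *)

Definition head_in B c := exists2 v, B v & (cells c v).1 != None.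

(* [C j] is P_j filled with a, [E j] extends R_j, and [y j] is P_j together with
   the common outer configuration x. *)
Definition universal_on (F : conf -> conf) (a : Sigma) B :=
  forall (k : nat) (C E : 'I_k -> conf),
    (forall j, head_in B (C j)) -> (forall j, head_in B (E j)) ->
    (forall j, agree (~` B) (C j) (const_conf d Q a)) ->
    trivIset setT (fun j => fwd_orbit F (C j)) ->
    exists (y : 'I_k -> conf) (t : nat),
      [/\ forall j, agree B (y j) (C j),
          forall i j, agree (~` B) (y i) (y j) &
          forall j, agree B (iter t F (y j)) (E j)].

Local Notation restr B c := (@Defs.restr _ _ _ B c).

Lemma restr_agree B c c' : restr B c = restr B c' <-> agree B c c'.
Proof.
split=> [/eq_sigLP e v /mem_set/e //|e].
by apply/eq_sigLP => v /set_mem/e.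
Qed.

Lemma restr_head B c : headed_patterns (restr B c) <-> head_in B c.
Proof.
split=> [[_ [v hv]]|[v Bv hv]].
  by exists (val v) => //; exact: set_mem (valP v).
split; first by exists c.
by exists (SigSub (mem_set Bv)).
Qed.

(** Trades partial patterns for full configurations compared by [agree], so that the region can vary
    freely. *)
Lemma physically_universalE F a :
  physically_universal F a <-> forall m, universal_on F a (@box d m).
Proof.
split=> [FU m k C E hC hE Ca triv|FU k m P R C hP hR CP triv].
  have [||||x [t [_ xt]]] := FU k m (fun j => restr _ (C j))
    (fun j => restr _ (E j)) C => //.
  - by move=> j; apply/restr_head.
  - by move=> j; apply/restr_head.
  - by move=> j; split=> //; apply/(restr_agree _ _ (const_conf d Q a)).
  have yex j : exists c, is_union (restr (@box d m) (C j)) x c /\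
      restr (@box d m) (iter t F c) = restr (@box d m) (E j).
    by have [c cu cE] := xt j; exists c.
  have [y yP] := choice yex.
  exists y, t; split.
  - by move=> j; apply/restr_agree; case: (yP j) => -[].
  - move=> i j; apply/restr_agree.
    by have [[_ ->] _] := yP i; have [[_ ->] _] := yP j.
  - by move=> j; apply/restr_agree; case: (yP j).
have Eex j : exists c, restr (@box d m) c = R j.
  by case: (hR j) => -[c _ cR] _; exists c.
have [E ER] := choice Eex.
have [||||y [t [yC yy yE]]] := FU m k C E => //.
- by move=> j; apply/restr_head; case: (CP j) => ->.
- by move=> j; apply/restr_head; rewrite ER.
- by move=> j; apply/restr_agree; case: (CP j).
(* Any [y j0] supplies the common exterior; when [k] is 0 a constant configuration does. *)
have [z zy] : exists z, forall j, restr (~` @box d m) (y j) = restr _ z.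
  have [[j0 _]|k0] := pselect (exists j : 'I_k, True).
    by exists (y j0) => j; apply/restr_agree.
  by exists (const_conf d Q a) => j; case: k0; exists j.
exists (restr _ z), t; split; first by exists z.
move=> j; exists (y j).
  by split; [case: (CP j) => <- _; apply/restr_agree|exact: zy].
by rewrite -ER; apply/restr_agree.
Qed.

(** If the window held no head, erasing the head of [c] would not change the image at [w], yet would
    make the image headless. *)
Lemma head_window h D c w : depends h D ->
  (forall c, headless c -> headless (h c)) ->
  (cells (h c) w).1 != None -> exists2 u, D w u & (cells c u).1 != None.
Proof.
move=> dep hl hw; apply: contrapT => noh.
pose c' : conf := (nohead d Q, c.2).
have cc' : agree (D w) c c'.
  move=> u Dwu; apply: injective_projections => //.
  by apply/eqP/negPn/negP => hu; apply: noh; exists u.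
have /headlessP/(_ w) : headless (h c') by exact: hl.
by move: hw; rewrite (dep _ _ _ cc') => /eqP.
Qed.

(* D and D' are the windows of g and of its inverse g'. *)
Lemma universal_on_conj (F g g' : conf -> conf) D D' a b B B' :
  cancel g g' -> cancel g' g ->
  depends g D -> depends g' D' ->
  (forall c, headless c -> headless (g c)) ->
  (forall c, headless c -> headless (g' c)) ->
  g (const_conf d Q a) = const_conf d Q b ->
  (forall w, B w -> D w `<=` B') ->
  (forall u v, B v -> D' u v -> B' u) ->
  (forall w u v, B v -> D' u v -> D w u -> D w `<=` B') ->
  universal_on F a B' -> universal_on (g \o F \o g') b B.
Proof.
move=> gK g'K depg depg' hlg hlg' gab DB D'B DD' FU k C E hC hE Cb triv.
(* As [g] preserves headlessness, [g' c] has a head at some [u]. The window of [u] then contains a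
   head of [c], which can only be at [v]. *)
have head' c : head_in B c -> head_in B' (g' c).
  move=> [v Bv hv].
  have [|u hu] := @not_headless (g' c).
    move=> /hlg; rewrite g'K => /headlessP/(_ v) /eqP.
    exact/negP.
  have [v' D'v' hv'] := head_window depg' hlg' hu.
  have vv' : v = v' by exact: (set_mem (valP c.1)).
  by exists u => //; apply: (D'B u v); rewrite ?vv'// -vv'.
have g'b : g' (const_conf d Q b) = const_conf d Q a by rewrite -gab gK.
have C'a j u : (forall v, B v -> ~ D' u v) ->
    cells (g' (C j)) u = cells (const_conf d Q a) u.
  move=> BD'; rewrite -g'b; apply: depg' => v D'v; apply: Cb => Bv.
  exact: BD' Bv D'v.
have iterE t c : iter t (g \o F \o g') (g c) = g (iter t F c).
  by elim: t => //= t ->; rewrite /= gK.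
have [|||| y [t [yC yy yE]]] := FU k (g' \o C) (g' \o E).
- by move=> j; exact: head'.
- by move=> j; exact: head'.
- by move=> j u B'u; apply: C'a => v Bv D'v; apply: B'u; exact: D'B Bv D'v.
(* A common point of two [F]-orbits is sent by [g] to a common point of the conjugated orbits. *)
- move=> i j _ _ [_ [[n _ <-] [m _ mn]]]; apply: triv => //.
  exists (g (iter n F (g' (C i)))); split.
    by exists n => //; rewrite -iterE g'K.
  by exists m => //; rewrite -{1}(g'K (C j)) iterE mn.
have yin j w : D w `<=` B' -> cells (g (y j)) w = cells (C j) w.
  by move=> DB'; rewrite -[in RHS](g'K (C j)); apply: depg => u /DB'/yC.
exists (g \o y), t; split=> /=.
- by move=> j w /DB; exact: yin.
- move=> i j w Bw.
  have [[u [v [Bv D'v Du]]]|far] :=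
      pselect (exists u v, [/\ B v, D' u v & D w u]).
    by rewrite !yin ?Cb //; exact: DD' Bv D'v Du.
  have {}far u : D w u -> forall v, B v -> ~ D' u v.
    by move=> Du v Bv D'v; apply: far; exists u, v.
  apply: depg => u /far uB.
  (* Inside [B'], at such a [u], both [y i] and [y j] carry the filling [a]; outside [B'] they share
     the completion. *)
  have [B'u|] := pselect (B' u); last exact: yy.
  by rewrite !yC //= !C'a.
- move=> j w /DB DB'; rewrite iterE -[in RHS](g'K (E j)).
  by apply: depg => u /DB'/yE.
Qed.

Lemma finite_box m : finite_set (@box d m).
Proof.
apply: (@sub_finite_set _ _
  (range (fun f : {ffun 'I_d -> 'I_m} => \col_i (f i : nat)%:Z : Zd))).
  move=> v vm.
  have {}vm i : 0 <= v i ord0 < m%:Z := vm i.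
  have vlt i : (absz (v i ord0) < m)%N by have := vm i; lia.
  exists [ffun i => Ordinal (vlt i)] => //.
  by apply/colP => i; rewrite mxE ffunE /= gez0_abs //; case/andP: (vm i).
exact/finite_image/finite_finset.
Qed.

Lemma translateK v : cancel (@translate d Q Sigma v) (translate (- v)).
Proof. by move=> c; apply: conf_ext => u; rewrite !cells_reindex subrK. Qed.

(** Shifting by K in every coordinate moves [cube K] into the box of side 2K. Since [F] is its own
    conjugate by this shift, [universal_on_conj] applies with one-cell windows. *)
Lemma universal_on_cube (F : conf -> conf) a K :
  (forall v c, F (translate v c) = translate v (F c)) ->
  physically_universal F a -> universal_on F a (cube K).
Proof.
move=> Ftr /physically_universalE/(_ (K + K)%N) FU.
pose s : Zd := \col_i K%:Z.
have sbox v : cube K v -> box (K + K) (v + s).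
  move=> vK i; have : (absz (v i 0%R) < K)%N := vK i; rewrite !mxE.
  by move: (v i 0%R) => z; lia.
have sK c : translate s (translate (- s) c) = c.
  by have := translateK (- s) c; rewrite opprK.
have -> : F = translate s \o F \o translate (- s).
  by apply: funext => c /=; rewrite Ftr sK.
apply: (@universal_on_conj F _ _ (fun w => [set w + s]) (fun u => [set u - s])
  a a (cube K) (@box d (K + K))) => //.
- exact: translateK.
- by move=> c c' w cc'; rewrite !cells_reindex; exact: cc'.
- by move=> c c' w cc'; rewrite !cells_reindex; exact: cc'.
- by move=> c /headlessP cN; apply/headlessP => v; rewrite cells_reindex.
- by move=> c /headlessP cN; apply/headlessP => v; rewrite cells_reindex.
- exact: conf_ext.
- by move=> w /sbox ? _ ->.
- by move=> u v Bv /= uv; move: Bv; rewrite uv => /sbox; rewrite subrK.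
- move=> w u v Bv /= uv wu _ ->; move: Bv; rewrite uv => /sbox.
  by rewrite subrK wu.
Qed.

End Space.

Theorem proposition1 (d : nat) (Q Sigma : finType)
  (d_gt0 : (0 < d)%N) (Q_gt0 : (0 < #|Q|)%N)
  (M : turing_machine d Q Sigma) (a b : Sigma) (g : homeo (conf d Q Sigma)) :
  groupG g ->
  g (const_conf d Q a) = const_conf d Q b ->
  physically_universal (tm_step M) a ->
  physically_universal (g \o tm_step M \o (g^-1)%g) b.
Proof.
move=> /(groupG_local d_gt0)[[[D depD [finD finD']] hlg]
  [[D' depD' [_ finD'']] hlg']] gab MU.
apply/physically_universalE => m.
have finB := @finite_box d m.
pose U := \bigcup_(v in @box d m) [set u | D' u v].
pose W := \bigcup_(u in U) [set w | D w u].
have finU : finite_set U by exact: bigcup_finite.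
have finW : finite_set W by apply: bigcup_finite => // u _; exact: finD'.
(* One cube for all three containments required by [universal_on_conj]: the windows over the box,
   the set [U], and the windows over [W], the cells whose window meets [U]. *)
have [K SK] : exists K, U `|` \bigcup_(w in @box d m `|` W) D w `<=` cube K.
  apply: finite_sub_cube; rewrite finite_setU; split=> //.
  by apply: bigcup_finite => //; rewrite finite_setU.
apply: (@universal_on_conj _ _ _ _ _ _ D D' a b _ (cube K)) => //.
- exact: homeo_funK.
- exact: homeo_invK.
- by move=> w Bw u Du; apply: SK; right; exists w => //; left.
- by move=> u v Bv D'v; apply: SK; left; exists v.
- move=> w u v Bv D'v Du u' Du'; apply: SK; right; exists w => //; right.
  by exists u => //; exists v.
- exact/universal_on_cube/MU/tm_step_translate.
Qed.
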